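(* Let $\mathbb{K}$ be a field. Any variety of non-associative algebras over $\mathbb{K}$ is a semi-abelian category.
   Context: Fix a field $\mathbb{K}$. A (non-associative) algebra over $\mathbb{K}$ is a $\mathbb{K}$-vector space $A$ with a bilinear multiplication $A\times A\to A$ (no associativity, unit, etc. is assumed). Morphisms are linear maps preserving the multiplication; the resulting category is $\mathsf{Alg}_{\mathbb{K}}$. Let $X=\{x_1,x_2,\dots\}$ be a countable set of variables and let $\mathbb{K}[M(X)]$ be the free non-associative $\mathbb{K}$-algebra on $X$ (the vector space with basis the free magma $M(X)$ on $X$, with bilinearly extended multiplication); its elements are called polynomials. A polynomial $\psi(x_1,\dots,x_n)$ is an identity of $A$ if $\psi(a_1,\dots,a_n)=0$ for all $a_1,\dots,a_n\in A$. A variety of non-associative algebras is the full subcategory of $\mathsf{Alg}_{\mathbb{K}}$ consisting of all algebras satisfying every identity in some given subset of $\mathbb{K}[M(X)]$. A category is pointed if it has a zero object. A regular epimorphism is a coequaliser of some parallel pair of morphisms. A category in which pullbacks, a terminal object and coequalisers exist is regular if every pullback of a regular epimorphism is a regular epimorphism. A pointed category with pullbacks is (Bourn) protomodular if the Split Short Five Lemma holds: given $f\colon A\to B$ a kernel of $g\colon B\to C$ with $g\circ s=1_C$, $k\colon D\to E$ a kernel of $q\colon E\to F$ with $q\circ t=1_F$, and $\alpha\colon A\to D$, $\beta\colon B\to E$, $\gamma\colon C\to F$ with $\beta f=k\alpha$, $q\beta=\gamma g$, $\beta s=t\gamma$, if $\alpha$ and $\gamma$ are isomorphisms then so is $\beta$.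 A homological category is one which is pointed, regular and protomodular. A regular category is Barr exact if every internal equivalence relation in it is a kernel pair; in a homological category this is equivalent to the condition that for every regular epimorphism $f\colon A\to B$ and every $k\colon K\to A$ which is a kernel of some morphism, the image (the monomorphism part of the regular epimorphism–monomorphism factorisation) of $f\circ k$ is again a kernel of some morphism. A semi-abelian category is a homological category which is Barr exact and in which the coproduct of any two objects exists. *)

(* Defs.v *)
From HB Require Import structures.
From mathcomp Require Import all_boot all_algebra.
From mathcomp Require Import finmap boolp.
From mathcomp Require Import monalg.

Set Implicit Arguments.
Unset Strict Implicit.
Unset Printing Implicit Defensive.

Import GRing.Theory.
Local Open Scope ring_scope.

Declare Scope cat_scope.
Delimit Scope cat_scope with cat.

Record category := Category {
  Obj :> Type;
  hom : Obj -> Obj -> Type;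
  idm : forall A, hom A A;
  compm : forall A B C, hom B C -> hom A B -> hom A C;
  compm1 : forall A B (f : hom A B), compm f (idm A) = f;
  comp1m : forall A B (f : hom A B), compm (idm B) f = f;
  compmA : forall A B C D (h : hom C D) (g : hom B C) (f : hom A B),
    compm h (compm g f) = compm (compm h g) f }.

Arguments hom {c} _ _.
Arguments idm {c} _.
Arguments compm {c A B C} _ _.
Notation "g ∘ f" := (compm g f) (at level 40, left associativity) : cat_scope.
Local Open Scope cat_scope.

Definition full_subcategory (C : category) (P : C -> Prop) : category :=
  @Category {A : C | P A}
    (fun A B => hom (sval A) (sval B))
    (fun A => idm (sval A))
    (fun _ _ _ g f => g ∘ f)
    (fun _ _ f => compm1 f)
    (fun _ _ f => comp1m f)
    (fun _ _ _ _ h g f => compmA h g f).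

Section Category.
Variable C : category.
Implicit Types A B D P R : C.

Definition is_iso A B (f : hom A B) : Prop :=
  exists g : hom B A, g ∘ f = idm A /\ f ∘ g = idm B.

Definition is_mono A B (f : hom A B) : Prop :=
  forall D (u v : hom D A), f ∘ u = f ∘ v -> u = v.

Definition is_initial Z : Prop := forall A, exists! f : hom Z A, True.

Definition is_terminal Z : Prop := forall A, exists! f : hom A Z, True.

Definition is_zero_object Z : Prop := is_initial Z /\ is_terminal Z.

Definition is_zero_morphism A B (f : hom A B) : Prop :=
  exists Z (u : hom A Z) (v : hom Z B), is_zero_object Z /\ f = v ∘ u.

Definition is_kernel A B D (k : hom A B) (g : hom B D) : Prop :=
  is_zero_morphism (g ∘ k) /\
  forall Q (q : hom Q B), is_zero_morphism (g ∘ q) ->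
    exists! u : hom Q A, k ∘ u = q.

Definition is_coequaliser A B Q (f g : hom A B) (q : hom B Q) : Prop :=
  q ∘ f = q ∘ g /\
  forall D (h : hom B D), h ∘ f = h ∘ g -> exists! u : hom Q D, u ∘ q = h.

Definition is_regular_epi B Q (q : hom B Q) : Prop :=
  exists A (f g : hom A B), is_coequaliser f g q.

(* P with p1, p2 is the pullback of the cospan f, g. *)
Definition is_pullback A B D P
    (f : hom A D) (g : hom B D) (p1 : hom P A) (p2 : hom P B) : Prop :=
  f ∘ p1 = g ∘ p2 /\
  forall Q (q1 : hom Q A) (q2 : hom Q B), f ∘ q1 = g ∘ q2 ->
    exists! u : hom Q P, p1 ∘ u = q1 /\ p2 ∘ u = q2.

Definition is_coproduct A B S (i1 : hom A S) (i2 : hom B S) : Prop :=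
  forall D (f1 : hom A D) (f2 : hom B D),
    exists! u : hom S D, u ∘ i1 = f1 /\ u ∘ i2 = f2.

Definition has_terminal : Prop := exists Z, is_terminal Z.

Definition has_pullbacks : Prop :=
  forall A B D (f : hom A D) (g : hom B D),
    exists P (p1 : hom P A) (p2 : hom P B), is_pullback f g p1 p2.

Definition has_coequalisers : Prop :=
  forall A B (f g : hom A B), exists Q (q : hom B Q), is_coequaliser f g q.

Definition has_binary_coproducts : Prop :=
  forall A B, exists S (i1 : hom A S) (i2 : hom B S), is_coproduct i1 i2.

Definition pointed : Prop := exists Z, is_zero_object Z.

Definition regular : Prop :=
  [/\ has_pullbacks, has_terminal, has_coequalisers &
    forall A B D P (f : hom A D) (g : hom B D) (p1 : hom P A) (p2 : hom P B),
      is_pullback f g p1 p2 -> is_regular_epi g -> is_regular_epi p1].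

Definition split_short_five : Prop :=
  forall (A B D : C) (f : hom A B) (g : hom B D) (s : hom D B)
         (A' B' D' : C) (k : hom A' B') (q : hom B' D') (t : hom D' B')
         (a : hom A A') (b : hom B B') (c : hom D D'),
    is_kernel f g -> g ∘ s = idm D ->
    is_kernel k q -> q ∘ t = idm D' ->
    b ∘ f = k ∘ a -> q ∘ b = c ∘ g -> b ∘ s = t ∘ c ->
    is_iso a -> is_iso c -> is_iso b.

Definition protomodular : Prop :=
  [/\ pointed, has_pullbacks & split_short_five].

Definition homological : Prop := [/\ pointed, regular & protomodular].

(* An internal equivalence relation on A: a jointly monic pair of morphisms
   R -> A that is reflexive, symmetric and transitive; transitivity is a
   morphism from the object R x_A R of composable pairs. *)
Record is_equivalence_relation R A (r1 r2 : hom R A) : Prop := {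
  eqrel_mono : forall Q (u v : hom Q R),
    r1 ∘ u = r1 ∘ v -> r2 ∘ u = r2 ∘ v -> u = v;
  eqrel_refl : exists d : hom A R, r1 ∘ d = idm A /\ r2 ∘ d = idm A;
  eqrel_sym : exists s : hom R R, r1 ∘ s = r2 /\ r2 ∘ s = r1;
  eqrel_trans : forall P (p1 p2 : hom P R), is_pullback r2 r1 p1 p2 ->
    exists m : hom P R, r1 ∘ m = r1 ∘ p1 /\ r2 ∘ m = r2 ∘ p2 }.

Definition is_kernel_pair R A (r1 r2 : hom R A) : Prop :=
  exists B (f : hom A B), is_pullback f f r1 r2.

Definition barr_exact : Prop :=
  regular /\
  forall R A (r1 r2 : hom R A),
    is_equivalence_relation r1 r2 -> is_kernel_pair r1 r2.

Definition semi_abelian : Prop :=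
  [/\ homological, barr_exact & has_binary_coproducts].

End Category.

Section Algebra.
Variable K : fieldType.

Record algebra := NAAlgebra {
  carrier :> lmodType K;
  amul : carrier -> carrier -> carrier;
  amul_bilinear : bilinear_for *:%R *:%R amul }.

Record alg_hom (A B : algebra) := AlgHom {
  alg_fun :> A -> B;
  alg_hom_linear : linear alg_fun;
  alg_hom_mul : {morph alg_fun : x y / amul x y} }.

Lemma alg_hom_eq (A B : algebra) (f g : alg_hom A B) : f =1 g -> f = g.
Proof.
case: f g => [f fl fm] [g gl gm] /= /funext fg; subst g.
by rewrite (Prop_irrelevance fl gl) (Prop_irrelevance fm gm).
Qed.

Definition alg_id (A : algebra) : alg_hom A A :=
  @AlgHom A A id (fun _ _ _ => erefl) (fun _ _ => erefl).

Definition alg_comp (A B D : algebra) (g : alg_hom B D) (f : alg_hom A B) :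
  alg_hom A D.
Proof.
apply: (@AlgHom A D (fun x => g (f x))).
- by move=> k x y; rewrite !alg_hom_linear.
- by move=> x y; rewrite !alg_hom_mul.
Defined.

Definition Alg : category.
Proof.
by apply: (@Category algebra alg_hom alg_id alg_comp) => *; apply: alg_hom_eq.
Defined.

End Algebra.

Inductive free_magma (X : Type) := MVar of X | MMul of free_magma X & free_magma X.

Section MagmaChoice.
Variable X : choiceType.

Fixpoint magma_tree (m : free_magma X) : GenTree.tree X :=
  match m with
  | MVar x => GenTree.Leaf x
  | MMul u v => GenTree.Node 0 [:: magma_tree u; magma_tree v]
  end.

Fixpoint tree_magma (t : GenTree.tree X) : option (free_magma X) :=
  match t with
  | GenTree.Leaf x => Some (MVar x)
  | GenTree.Node _ [:: s; t] =>
      match tree_magma s, tree_magma t with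
      | Some u, Some v => Some (MMul u v)
      | _, _ => None
      end
  | _ => None
  end.

Lemma magma_treeK : pcancel magma_tree tree_magma.
Proof. by elim=> //= u -> v ->. Qed.

HB.instance Definition _ := Choice.copy (free_magma X) (pcan_type magma_treeK).

End MagmaChoice.

Section FreeAlgebra.
Variables (K : fieldType) (X : choiceType).
Local Notation F := {malg K[free_magma X]}.
Implicit Types p q r : F.

Definition free_mul p q : F :=
  \sum_(u <- msupp p) \sum_(v <- msupp q) << p@_u * q@_v *g MMul u v >>.

(* The linear extension to K[M(X)] of a map h defined on the basis M(X). *)
Definition lin_ext (V : lmodType K) (h : free_magma X -> V) p : V :=
  \sum_(u <- msupp p) p@_u *: h u.

Lemma lin_extE (V : lmodType K) (h : free_magma X -> V) (d : {fset free_magma X}) p :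
  (msupp p `<=` d)%fset -> lin_ext h p = \sum_(u <- d) p@_u *: h u.
Proof.
move=> pd; rewrite /lin_ext (big_fset_incl _ pd) //= => u _ up.
by rewrite mcoeff_outdom // scale0r.
Qed.

Lemma lin_ext_linear (V : lmodType K) (h : free_magma X -> V) : linear (lin_ext h).
Proof.
move=> c p q; pose d := (msupp p `|` msupp q `|` msupp (c *: p + q))%fset.
have pd : (msupp p `<=` d)%fset.
  exact: fsubset_trans (fsubsetUl _ _) (fsubsetUl _ _).
have qd : (msupp q `<=` d)%fset.
  exact: fsubset_trans (fsubsetUr _ _) (fsubsetUl _ _).
rewrite (lin_extE h pd) (lin_extE h qd).
rewrite (lin_extE h (fsubsetUr _ _ : _ `<=` d)%fset).
rewrite scaler_sumr -big_split /=.
by apply: eq_bigr => u _; rewrite mcoeffD mcoeffZ scalerDl scalerA.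
Qed.

Lemma lin_extU (V : lmodType K) (h : free_magma X -> V) u :
  lin_ext h << u >> = h u.
Proof. by rewrite /lin_ext msuppU oner_eq0 big_seq_fset1 mcoeffUU scale1r. Qed.

Lemma monalgUZ (c k : K) (u : free_magma X) :
  << c * k *g u >> = c *: << k *g u >> :> F.
Proof.
by apply/malgP => v; rewrite mcoeffZ !mcoeffU; case: eqP; rewrite ?mulr0.
Qed.

Lemma lin_eq (V : lmodType K) (f g : F -> V) : linear f -> linear g ->
  (forall u, f << u >> = g << u >>) -> f =1 g.
Proof.
move=> fl gl fg p.
have lin0 (h : F -> V) : linear h -> h 0 = 0.
  by move=> hl; have := hl (- 1) 0 0; rewrite scaler0 addr0 scaleN1r addNr.
rewrite [p]monalgE; elim: (enum_fset _) => [|u s IH].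
  by rewrite big_nil !lin0.
by rewrite big_cons -[p@_u]mulr1 monalgUZ fl gl fg IH.
Qed.

Lemma free_mulEl p q :
  free_mul p q = lin_ext (fun u => lin_ext (fun v => << MMul u v >>) q) p.
Proof.
rewrite /free_mul /lin_ext; apply: eq_bigr => u _; rewrite scaler_sumr.
apply: eq_bigr => v _.
by rewrite -{1}[q@__]mulr1 !monalgUZ.
Qed.

Lemma free_mul_bilinear : bilinear_for *:%R *:%R free_mul.
Proof.
split=> [q c p p'|p c q q'] /=; rewrite !free_mulEl ?lin_ext_linear //.
rewrite /lin_ext scaler_sumr -big_split /=; apply: eq_bigr => u _.
by rewrite -!/(lin_ext _ _) lin_ext_linear scalerDr !scalerA mulrC.
Qed.

Definition free_algebra : algebra K := NAAlgebra free_mul_bilinear.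

End FreeAlgebra.

Definition na_polynomial (K : fieldType) : Type := free_algebra K nat.

Section Identities.
Variables (K : fieldType) (A : algebra K).

Fixpoint magma_eval (X : Type) (a : X -> A) (m : free_magma X) : A :=
  match m with
  | MVar x => a x
  | MMul u v => amul (magma_eval a u) (magma_eval a v)
  end.

Definition peval (X : choiceType) (a : X -> A) (p : free_algebra K X) : A :=
  lin_ext (magma_eval a) p.

(* peval a is the algebra morphism given by the universal property of the free
   algebra: it extends a along the inclusion of the variables. *)
Lemma peval_var (X : choiceType) (a : X -> A) x : peval a << MVar x >> = a x.
Proof. exact: lin_extU. Qed.

Lemma peval_linear (X : choiceType) (a : X -> A) : linear (peval a).
Proof. exact: lin_ext_linear. Qed.

Lemma peval_mul (X : choiceType) (a : X -> A) :
  {morph peval a : p q / amul p q}.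
Proof.
move=> p q; pose L r s := peval a (free_mul r s).
pose M r s := amul (peval a r) (peval a s).
have [fl fr] := free_mul_bilinear K X; have [Al Ar] := amul_bilinear A.
have Ll s : linear (L ^~ s) by move=> c r t; rewrite /L fl peval_linear.
have Lr r : linear (L r) by move=> c s t; rewrite /L fr peval_linear.
have Ml s : linear (M ^~ s) by move=> c r t; rewrite /M peval_linear Al.
have Mr r : linear (M r) by move=> c s t; rewrite /M peval_linear Ar.
apply: (@lin_eq _ _ _ (L ^~ q) (M ^~ q) (Ll q) (Ml q)) => u /=.
apply: (@lin_eq _ _ _ (L _) (M _) (Lr _) (Mr _)) => v.
by rewrite /L /M /peval free_mulEl !lin_extU.
Qed.

(* The variables are indexed by nat, and a valuation assigns a value to all of
   them; the value of a polynomial depends only on the variables in it. *)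
Definition is_identity (psi : na_polynomial K) : Prop :=
  forall a : nat -> A, peval a psi = 0.

End Identities.

Definition variety (K : fieldType) (I : na_polynomial K -> Prop) : category :=
  full_subcategory
    (fun A : Alg K => forall psi, I psi -> is_identity A psi).

(* Main.v *)
From HB Require Import structures.
From mathcomp Require Import all_boot all_algebra.
From mathcomp Require Import boolp monalg.
Require Import Defs.

(** All universal objects are obtained from three constructions: subalgebras,
    quotients by ideals, and free algebras. In a variety the regular epimorphisms
    are exactly the surjective morphisms, which are clearly stable under
    pullback. The Split Short Five Lemma is a diagram chase. If R is an
    equivalence relation on A, the elements related to 0 form an ideal J, by
    reflexivity and linearity alone, and R is the kernel pair of A -> A/J.
    Coequalisers and coproducts are quotients by the ideal of those elements
    which vanish under every morphism that has to factor through them; such a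
    quotient satisfies the identities because all these morphisms land in the
    variety. *)

Set Implicit Arguments.
Unset Strict Implicit.
Unset Printing Implicit Defensive.

Import GRing.Theory.
Local Open Scope ring_scope.
Local Open Scope quotient_scope.
Local Open Scope cat_scope.

(** * Morphisms of algebras: constructing, inverting and factoring them *)

Section Algebras.
Variable K : fieldType.
Implicit Types A B D : algebra K.

HB.instance Definition _ A B (f : alg_hom A B) :=
  GRing.isLinear.Build K A B *:%R (alg_fun f) (alg_hom_linear f).

Definition surjective A B (f : A -> B) := forall y, exists x, f x = y.

Lemma amulPl A (c : K) (x y z : A) :
  amul (c *: x + y) z = c *: amul x z + amul y z.
Proof. by have [l _] := amul_bilinear A; rewrite l. Qed.

Lemma amulPr A (c : K) (x y z : A) :
  amul x (c *: y + z) = c *: amul x y + amul x z.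
Proof. by have [_ r] := amul_bilinear A; rewrite r. Qed.

Lemma amul0l A (x : A) : amul 0 x = 0.
Proof. by have := amulPl (-1) 0 0 x; rewrite scaler0 addr0 scaleN1r addNr. Qed.

Lemma amul0r A (x : A) : amul x 0 = 0.
Proof. by have := amulPr (-1) x 0 0; rewrite scaler0 addr0 scaleN1r addNr. Qed.

Lemma amulBl A (x y z : A) : amul (x - y) z = amul x z - amul y z.
Proof. by rewrite addrC -scaleN1r amulPl scaleN1r addrC. Qed.

Lemma amulBr A (x y z : A) : amul x (y - z) = amul x y - amul x z.
Proof. by rewrite addrC -scaleN1r amulPr scaleN1r addrC. Qed.

Lemma injective_of_ker A B (f : alg_hom A B) :
  (forall x, f x = 0 -> x = 0) -> injective f.
Proof.
by move=> f0 x y fxy; apply/subr0_eq/f0; rewrite linearB /= fxy subrr.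
Qed.

(** Choice turns the relation into a function, and single-valuedness makes it respect the
    operations. Mediating morphisms arise this way when only the existence of each value is
    known. *)
Lemma hom_of_graph A B (G : A -> B -> Prop) :
    (forall x, exists y, G x y) ->
    (forall x y y', G x y -> G x y' -> y = y') ->
    (forall c x x' y y', G x y -> G x' y' -> G (c *: x + x') (c *: y + y')) ->
    (forall x x' y y', G x y -> G x' y' -> G (amul x x') (amul y y')) ->
  exists f : alg_hom A B, forall x, G x (f x).
Proof.
move=> Gtot Gfun GP GM; have [f Gf] := choice Gtot.
have fl : linear f by move=> c x y; apply: Gfun (Gf _) _; apply: GP.
have fm : {morph f : x y / amul x y}.
  by move=> x y; apply: Gfun (Gf _) _; apply: GM.
by exists (AlgHom fl fm).
Qed.

Lemma hom_inverse A B (f : alg_hom A B) : injective f -> surjective f ->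
  exists g : alg_hom B A, cancel f g /\ cancel g f.
Proof.
move=> fI fS.
have [//|y x x' <- /fI->//|c x x' y y' <- <-|x x' y y' <- <-|g gP] :=
  @hom_of_graph B A (fun y x => f x = y).
- exact: alg_hom_linear.
- exact: alg_hom_mul.
- by exists g; split=> // x; apply: fI.
Qed.

(** The graph is the image of [h] along [q]; it is single-valued because [q x = q y] puts [x - y] in
    the kernel of [q], hence in that of [h]. *)
Lemma hom_factor A Q D (q : alg_hom A Q) (h : alg_hom A D) :
    surjective q -> (forall x, q x = 0 -> h x = 0) ->
  exists u : alg_hom Q D, forall x, u (q x) = h x.
Proof.
move=> qS qh.
have qhE x y : q x = q y -> h x = h y.
  by move=> qxy; apply/subr0_eq; rewrite -linearB /= qh // linearB /= qxy subrr.
have [y|y z z'|c y y' z z'|y y' z z'|u uP] :=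
    @hom_of_graph Q D (fun y z => exists2 x, q x = y & h x = z).
- by have [x <-] := qS y; exists (h x), x.
- by move=> [x <- <-] [x' /qhE->].
- by move=> [x <- <-] [x' <- <-]; exists (c *: x + x'); rewrite linearP.
- by move=> [x <- <-] [x' <- <-]; exists (amul x x'); rewrite alg_hom_mul.
- by exists u => x; have [x' /qhE-> <-] := uP (q x).
Qed.

(** * Subalgebras *)

Section Subalgebra.
Variables (A : algebra K) (S : A -> Prop).
Hypothesis S0 : S 0.
Hypothesis SP : forall c x y, S x -> S y -> S (c *: x + y).
Hypothesis SM : forall x y, S x -> S y -> S (amul x y).

Definition sub_pred : {pred A} := fun x => `[< S x >].

Lemma sub_predP x : reflect (S x) (x \in sub_pred).
Proof. exact: asboolP. Qed.

Lemma sub_pred_submod : subsemimod_closed sub_pred.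
Proof.
split; [split|].
- exact/sub_predP.
- move=> x y /sub_predP Sx /sub_predP Sy; apply/sub_predP.
  by rewrite -[x]scale1r; apply: SP.
- move=> c x /sub_predP Sx; apply/sub_predP.
  by rewrite -[_ *: _]addr0; apply: SP.
Qed.

HB.instance Definition _ :=
  GRing.isSubmodClosed.Build K A sub_pred sub_pred_submod.

Record sub_sort := SubElt { sub_val : A; _ : sub_val \in sub_pred }.
HB.instance Definition _ := [isSub for sub_val].
HB.instance Definition _ := [Choice of sub_sort by <:].
HB.instance Definition _ := [SubChoice_isSubLmodule of sub_sort by <:].

Definition sub_mul (x y : sub_sort) : sub_sort :=
  SubElt (introT (sub_predP _)
    (SM (elimT (sub_predP _) (valP x)) (elimT (sub_predP _) (valP y)))).

Lemma sub_val_linear : linear sub_val.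
Proof. by []. Qed.

Lemma sub_mul_bilinear : bilinear_for *:%R *:%R sub_mul.
Proof.
split=> [z c x y|z c x y]; apply: val_inj => /=.
- by rewrite amulPl.
- by rewrite amulPr.
Qed.

Lemma subalgebraP : exists (B : algebra K) (i : alg_hom B A),
  injective i /\ forall x, S x <-> exists y, i y = x.
Proof.
pose B := NAAlgebra sub_mul_bilinear.
exists B, (@AlgHom K B A _ sub_val_linear (fun _ _ => erefl)); split.
  exact: val_inj.
move=> x; split=> [Sx|[y <-]]; last exact/sub_predP/(valP y).
by exists (SubElt (introT (sub_predP _) Sx)).
Qed.

End Subalgebra.

(** * Quotients by two-sided ideals *)

Section Quotient.
Variables (A : algebra K) (J : A -> Prop).
Hypothesis J0 : J 0.
Hypothesis JP : forall c x y, J x -> J y -> J (c *: x + y).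
Hypothesis JMl : forall x y, J x -> J (amul x y).
Hypothesis JMr : forall x y, J y -> J (amul x y).

(* A copy of [sub_pred J], on which canonical inference would leave the
   closure hypotheses of the previous section unresolved. *)
Definition ideal_pred : {pred A} := fun x => `[< J x >].

Lemma ideal_predP x : reflect (J x) (x \in ideal_pred).
Proof. exact: asboolP. Qed.

HB.instance Definition _ :=
  GRing.isSubmodClosed.Build K A ideal_pred (sub_pred_submod J0 JP).

Definition quo := Quotient.quot ideal_pred.
HB.instance Definition _ := GRing.Zmodule.on quo.

Lemma quoW (P : quo -> Prop) : (forall x : A, P (\pi_quo x)) -> forall x, P x.
Proof. by move=> Ppi x; rewrite -[x]reprK. Qed.

Lemma quo_eqP (x y : A) : reflect (\pi_quo x = \pi_quo y) (x - y \in ideal_pred).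
Proof. by rewrite Quotient.idealrBE; apply: eqP. Qed.

Lemma quoD (x y : A) : \pi_quo (x + y) = \pi_quo x + \pi_quo y.
Proof. by rewrite !piE. Qed.

Lemma quo_repr (x : A) : x - repr (\pi_quo x) \in ideal_pred.
Proof. by apply/quo_eqP; rewrite reprK. Qed.

(** Scaling and product are computed on chosen representatives; [quo_scaleE] and [quo_mulE] show
    independence of the choice. *)
Definition quo_scale (c : K) (x : quo) : quo := \pi_quo (c *: repr x).
Definition quo_mul (x y : quo) : quo := \pi_quo (amul (repr x) (repr y)).

Lemma quo_scaleE c x : quo_scale c (\pi_quo x) = \pi_quo (c *: x).
Proof. by apply/esym/quo_eqP; rewrite -scalerBr rpredZ ?quo_repr. Qed.

Lemma quo_mulE x y : quo_mul (\pi_quo x) (\pi_quo y) = \pi_quo (amul x y).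
Proof.
apply/esym/quo_eqP; set x' := repr _; set y' := repr _.
(* [x y - x' y' = (x - x') y + x' (y - y')], with one absorption law for each summand. *)
rewrite -(subrKA (amul x' y)) -amulBl -amulBr.
apply: rpredD; apply/ideal_predP; [apply: JMl|apply: JMr];
  exact/ideal_predP/quo_repr.
Qed.

Lemma quo_scaleA c d x : quo_scale c (quo_scale d x) = quo_scale (c * d) x.
Proof. by elim/quoW: x => x; rewrite !quo_scaleE scalerA. Qed.

Lemma quo_scale1 : left_id 1 quo_scale.
Proof. by elim/quoW=> x; rewrite quo_scaleE scale1r. Qed.

Lemma quo_scaleDr : right_distributive quo_scale +%R.
Proof.
move=> c; elim/quoW=> x; elim/quoW=> y.
by rewrite -quoD !quo_scaleE -quoD scalerDr.
Qed.

Lemma quo_scaleDl x : {morph quo_scale^~ x : c d / c + d}.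
Proof. by elim/quoW: x => x c d; rewrite !quo_scaleE -quoD scalerDl. Qed.

HB.instance Definition _ := GRing.Zmodule_isLmodule.Build K quo
  quo_scaleA quo_scale1 quo_scaleDr quo_scaleDl.

Lemma quo_pi_linear : linear (\pi_quo : A -> quo).
Proof. by move=> c x y; rewrite quoD -quo_scaleE. Qed.

Lemma quo_mul_bilinear : bilinear_for *:%R *:%R quo_mul.
Proof.
split=> [z c x y|x c y z] /=; elim/quoW: x => x; elim/quoW: y => y;
  elim/quoW: z => z; rewrite -quo_pi_linear !quo_mulE -quo_pi_linear.
- by rewrite amulPl.
- by rewrite amulPr.
Qed.

Lemma quotientP : exists (Q : algebra K) (q : alg_hom A Q),
  surjective q /\ forall x, q x = 0 <-> J x.
Proof.
pose Q := NAAlgebra quo_mul_bilinear.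
have qM : {morph (\pi_quo : A -> Q) : x y / amul x y}.
  by move=> x y; rewrite /= quo_mulE.
pose q := @AlgHom K A Q _ quo_pi_linear qM.
exists Q, q; split=> [|x]; first by elim/quoW=> x; exists x.
(* Writing the zero of [Q] as [q 0] turns the claim into an equality of classes, to which [quo_eqP]
   applies. *)
have <- : q 0 = 0 by exact: linear0.
split=> [/quo_eqP/ideal_predP|Jx]; first by rewrite subr0.
by apply/quo_eqP/ideal_predP; rewrite subr0.
Qed.

End Quotient.

(** * Products and pullbacks of algebras *)

Section Product.
Variables A B : algebra K.

Definition prod_mul (x y : A * B) : A * B := (amul x.1 y.1, amul x.2 y.2).

Lemma prod_mul_bilinear : bilinear_for *:%R *:%R prod_mul.
Proof.
by split=> [z c x y|x c y z]; congr pair; rewrite /= ?amulPl ?amulPr.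
Qed.

Definition prod_algebra : algebra K := NAAlgebra prod_mul_bilinear.

Definition prod_fst : alg_hom prod_algebra A :=
  @AlgHom K prod_algebra A fst (fun _ _ _ => erefl) (fun _ _ => erefl).

Definition prod_snd : alg_hom prod_algebra B :=
  @AlgHom K prod_algebra B snd (fun _ _ _ => erefl) (fun _ _ => erefl).

End Product.

(** The fibre product is cut out of the product algebra. The last two clauses encode universality by
    elements: compatible pairs lift, and the projections are jointly injective. *)
Lemma pullbackP A B D (f : alg_hom A D) (g : alg_hom B D) :
  exists (P : algebra K) (p1 : alg_hom P A) (p2 : alg_hom P B),
    [/\ forall z, f (p1 z) = g (p2 z),
        forall x y, f x = g y -> exists z, p1 z = x /\ p2 z = y &
        forall z z', p1 z = p1 z' -> p2 z = p2 z' -> z = z'].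
Proof.
have [||u v fgu fgv|P [i [iI iP]]] :=
    @subalgebraP (prod_algebra A B) (fun z => f z.1 = g z.2).
- by rewrite !linear0.
- by move=> c u v fgu fgv; rewrite !linearP /= fgu fgv.
- by rewrite /= !alg_hom_mul fgu fgv.
exists P, (alg_comp (prod_fst A B) i), (alg_comp (prod_snd A B) i).
split=> [z|x y|z z' /= e1 e2].
- by apply/iP; exists z.
- by move=> /(iP (x, y))[z iz]; exists z; rewrite /= iz.
- by apply: iI; rewrite [i z]surjective_pairing e1 e2 -surjective_pairing.
Qed.

(** * The zero algebra, carried by row vectors of length 0, and zero morphisms *)

Definition zero_mul (x y : 'rV[K]_0) : 'rV[K]_0 := 0.

Lemma zero_mul_bilinear : bilinear_for *:%R *:%R zero_mul.
Proof. by split=> [z c x y|x c y z]; rewrite [LHS]thinmx0 [RHS]thinmx0. Qed.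

Definition zero_algebra : algebra K := NAAlgebra zero_mul_bilinear.

Lemma zero_algebra_eq (x y : zero_algebra) : x = y.
Proof. by rewrite (thinmx0 x) (thinmx0 y). Qed.

Lemma zero_hom_mul A B : {morph (fun _ : A => 0 : B) : x y / amul x y}.
Proof. by move=> x y; rewrite amul0l. Qed.

Lemma zero_hom_linear A B : linear (fun _ : A => 0 : B).
Proof. by move=> c x y; rewrite scaler0 addr0. Qed.

Definition zero_hom A B : alg_hom A B :=
  AlgHom (@zero_hom_linear A B) (@zero_hom_mul A B).

(** * The universal property of free algebras *)

Section Evaluation.
Variable X : choiceType.

Definition peval_hom A (a : X -> A) : alg_hom (free_algebra K X) A :=
  AlgHom (peval_linear a) (peval_mul a).

(** Linearity reduces the claim to basis monomials, which are handled by induction as iterated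
    products of variables. *)
Lemma free_hom_eq A (f g : alg_hom (free_algebra K X) A) :
  (forall x, f << MVar x >> = g << MVar x >>) -> f =1 g.
Proof.
move=> fg; apply: lin_eq (alg_hom_linear f) (alg_hom_linear g) _.
elim=> [//|u fgu v fgv].
suff -> : << MMul u v >> = amul (<< u >> : free_algebra K X) << v >>.
  by rewrite !alg_hom_mul fgu fgv.
by rewrite /= free_mulEl !lin_extU.
Qed.

(** Both sides, as functions of [p], are morphisms out of the free algebra that agree on
    variables. *)
Lemma hom_peval A B (h : alg_hom A B) (a : X -> A) p :
  h (peval a p) = peval (h \o a) p.
Proof.
apply: (@free_hom_eq _ (alg_comp h (peval_hom a)) (peval_hom (h \o a))) => x.
by rewrite /= !peval_var.
Qed.

Lemma free_algebraP : exists (F : algebra K) (g : X -> F),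
  (forall A (a : X -> A), exists h : alg_hom F A, forall x, h (g x) = a x) /\
  (forall A (f h : alg_hom F A), (forall x, f (g x) = h (g x)) -> f =1 h).
Proof.
exists (free_algebra K X), (fun x => << MVar x >>).
split=> A; last exact: free_hom_eq.
by move=> a; exists (peval_hom a) => x; apply: peval_var.
Qed.

End Evaluation.
End Algebras.

(** * Membership in the variety *)

Section Variety.
Variables (K : fieldType) (I : na_polynomial K -> Prop).
Implicit Types A B D P Q : variety I.

Definition satisfies (A : algebra K) := forall psi, I psi -> is_identity A psi.

Definition variety_obj (A : algebra K) (AI : satisfies A) : variety I :=
  exist _ A AI.

(** A morphism [h] sends a value of [psi] in [A] to a value of [psi] in [D], which is zero; so
    separation by such morphisms forces the identities in [A]. *)
Lemma satisfies_joint (A : algebra K) :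
    (forall x : A, (forall D (h : alg_hom A (sval D)), h x = 0) -> x = 0) ->
  satisfies A.
Proof.
move=> A0 psi Ipsi a; apply: A0 => D h.
by rewrite hom_peval (svalP D _ Ipsi).
Qed.

Lemma satisfies_sub (A : algebra K) B (i : alg_hom A (sval B)) :
  injective i -> satisfies A.
Proof.
by move=> iI; apply: satisfies_joint => x /(_ _ i) ix; apply: iI;
  rewrite ix linear0.
Qed.

(** A valuation in [B] lifts along [q], by choice, to one in [A], where the identity holds. *)
Lemma satisfies_quotient A (B : algebra K) (q : alg_hom (sval A) B) :
  surjective q -> satisfies B.
Proof.
move=> qS psi Ipsi a; have [a' a'E] := choice (fun n => qS (a n)).
have -> : a = q \o a' by apply/funext => n; rewrite /= a'E.
by rewrite -hom_peval (svalP A _ Ipsi) linear0.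
Qed.

(** [T] selects the morphisms that must factor through [q]; the ideal is the intersection of their
    kernels. Quantifying over all [D] raises no size issue, since the ideal is a predicate in
    [Prop]. *)
Lemma separated_quotientP (F : algebra K)
    (T : forall D, alg_hom F (sval D) -> Prop) :
  exists Q (q : alg_hom F (sval Q)), surjective q /\
    forall x, q x = 0 <-> forall D h, @T D h -> h x = 0.
Proof.
have [|||x y Jy D h Th|Q [q [qS qP]]] :=
    @quotientP K F (fun x => forall D h, @T D h -> h x = 0).
- by move=> D h _; rewrite linear0.
- move=> c x y Jx Jy D h Th.
  by rewrite linearP /= (Jx _ _ Th) (Jy _ _ Th) scaler0 addr0.
- by move=> x y Jx D h Th; rewrite alg_hom_mul (Jx _ _ Th) amul0l.
- by rewrite alg_hom_mul (Jy _ _ Th) amul0r.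
have QI : satisfies Q.
  apply: satisfies_joint => y Qy; have [x xy] := qS y; rewrite -xy.
  apply/qP => D h Th.
  (* [h] factors through [q] as some [u], and [u] kills [y] by [Qy]. *)
  have [z /qP qz|u uP] := hom_factor qS (h := h); first exact: qz.
  by rewrite -uP xy Qy.
by exists (variety_obj QI), q.
Qed.

(** * Isomorphisms, zero morphisms, pullbacks and monomorphisms in terms of elements *)

Lemma homP A B (f g : hom A B) : f = g <-> alg_fun f =1 alg_fun g.
Proof. by split=> [->|/alg_hom_eq]. Qed.

Lemma iso_bij A B (f : hom A B) :
  is_iso f <-> injective (alg_fun f) /\ surjective (alg_fun f).
Proof.
split=> [[g [/homP gf /homP fg]]|[fI /hom_inverse[//|g [gf fg]]]].
  split=> [|y]; last by exists (alg_fun g y); apply: fg.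
  exact: (can_inj (gf : cancel (alg_fun f) (alg_fun g))).
by exists g; split; apply/homP.
Qed.

Definition zero_object : variety I :=
  @variety_obj (zero_algebra K) (fun _ _ _ => zero_algebra_eq _ _).

Lemma zero_objectP : is_zero_object zero_object.
Proof.
split=> A; exists (zero_hom _ _); split=> // f _; apply/homP => x /=.
- by rewrite (zero_algebra_eq x 0) linear0.
- exact: zero_algebra_eq.
Qed.

Lemma zero_morphismP A B (f : hom A B) :
  is_zero_morphism f <-> forall x, alg_fun f x = 0.
Proof.
split=> [[Z [u [v [[Zi _] ->]]]] x|f0].
  have [w [_ wP]] := Zi B.
  (* Morphisms out of the initial object [Z] are unique, so [v] is the zero map. *)
  by rewrite -(wP v) // (wP (zero_hom _ _)).
exists zero_object, (zero_hom _ _), (zero_hom _ _).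
by split; [exact: zero_objectP | apply/homP => x; rewrite f0].
Qed.

Lemma variety_pullbackP A B D (f : hom A D) (g : hom B D) :
  exists P (p1 : hom P A) (p2 : hom P B), is_pullback f g p1 p2 /\
    forall x y, alg_fun f x = alg_fun g y ->
      exists z, alg_fun p1 z = x /\ alg_fun p2 z = y.
Proof.
have [P [p1 [p2 [fg lift eqP]]]] := pullbackP f g.
have PI : satisfies P.
  apply: satisfies_joint => x Px.
  by apply: eqP; rewrite linear0; apply: Px.
exists (variety_obj PI), p1, p2; split=> //; split; first exact/homP.
move=> Q q1 q2 /homP fgq.
have [x|x z z'|c x x' z z'|x x' z z'|u uP] := @hom_of_graph K (sval Q) P
    (fun x z => p1 z = alg_fun q1 x /\ p2 z = alg_fun q2 x).
- exact: lift (fgq x).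
- by move=> [<- <-] [e1 e2]; apply: eqP.
- by move=> [e1 e2] [e3 e4]; rewrite !linearP /= e1 e2 e3 e4.
- by move=> [e1 e2] [e3 e4]; rewrite !alg_hom_mul e1 e2 e3 e4.
exists u; split=> [|v [/homP v1 /homP v2]].
  by split; apply/homP => x; have [] := uP x.
by apply/homP => x; have [e1 e2] := uP x; apply: eqP;
  rewrite (e1, e2); apply/esym; [apply: v1|apply: v2].
Qed.

(** The explicit pullback maps to any other one by a comparison morphism, which transports lifts of
    elements. *)
Lemma pullback_lift A B D P (f : hom A D) (g : hom B D)
    (p1 : hom P A) (p2 : hom P B) x y :
    is_pullback f g p1 p2 -> alg_fun f x = alg_fun g y ->
  exists z, alg_fun p1 z = x /\ alg_fun p2 z = y.
Proof.
move=> [_ Pu] fgxy; have [P' [q1 [q2 [[fgq _] lift]]]] := variety_pullbackP f g.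
have [u [[/homP u1 /homP u2] _]] := Pu _ _ _ fgq.
have [z [<- <-]] := lift _ _ fgxy.
by exists (alg_fun u z); split; [apply: u1 | apply: u2].
Qed.

(* The test object is the free algebra of the variety on one generator. *)
Lemma jointly_mono_inj R A B (f : hom R A) (g : hom R B) :
    (forall Q (u v : hom Q R), f ∘ u = f ∘ v -> g ∘ u = g ∘ v -> u = v) ->
  forall x y, alg_fun f x = alg_fun f y -> alg_fun g x = alg_fun g y -> x = y.
Proof.
move=> fgI x y fxy gxy; have [F [gen [Fext Feq]]] := free_algebraP K unit.
(* With no condition on the morphisms, this ideal consists of the elements killed by every morphism
   into the variety, so [Q] is the relatively free algebra. *)
have [Q [q [qS qP]]] := @separated_quotientP F (fun _ _ => True).
have extend (z : sval R) : exists u : alg_hom (sval Q) (sval R),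
    u (q (gen tt)) = z.
  have [h hz] := Fext _ (fun=> z).
  have [t /qP qt|u uP] := hom_factor qS (h := h); first exact: (qt R).
  by exists u; rewrite uP.
have [u ux] := extend x; have [v vy] := extend y.
have agree D (h : hom R D) : alg_fun h x = alg_fun h y -> h ∘ u = h ∘ v.
  move=> hxy; apply/homP => t; have [w <-] := qS t.
  apply: (Feq _ (alg_comp h (alg_comp u q)) (alg_comp h (alg_comp v q))) => -[].
  by rewrite /= ux vy.
by rewrite -ux -vy (fgI _ _ _ (agree _ _ fxy) (agree _ _ gxy)).
Qed.

(** * Regular epimorphisms and coequalisers *)

Lemma hom_factor_unique A Q D (q : hom A Q) (h : hom A D) :
    surjective (alg_fun q) ->
    (forall x, alg_fun q x = 0 -> alg_fun h x = 0) ->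
  exists! u : hom Q D, u ∘ q = h.
Proof.
move=> qS qh; have [u uP] := hom_factor qS qh.
exists u; split=> [|v /homP vP]; first exact/homP.
by apply/homP => y; have [x <-] := qS y; rewrite uP; apply/esym/vP.
Qed.

(** If [q] is a coequaliser, its corestriction to its image [S] factors as [u ∘ q]; then [i' ∘ u]
    fixes [q], so it is the identity and the inclusion of [S] is onto. Conversely, a surjection is
    the coequaliser of its kernel pair. *)
Lemma regular_epiP A B (q : hom A B) :
  is_regular_epi q <-> surjective (alg_fun q).
Proof.
split=> [[E [f [g [/homP qfg qU]]]] y|qS].
- have [||u v [a au] [b bv]|S [i [iI iP]]] :=
    @subalgebraP K (sval B) (fun y => exists x, alg_fun q x = y).
  + by exists 0; rewrite linear0.
  + by move=> c u v [a <-] [b <-]; exists (c *: a + b); rewrite linearP.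
  + by exists (amul a b); rewrite alg_hom_mul au bv.
  have SI := satisfies_sub iI.
  have [x|x z z' <- /iI//|c x x' z z' e e'|x x' z z' e e'|r rP] :=
    @hom_of_graph K (sval A) S (fun x z => i z = alg_fun q x).
  + by apply/iP; exists x.
  + by rewrite !linearP /= e e'.
  + by rewrite !alg_hom_mul e e'.
  pose S' := variety_obj SI; pose i' : hom S' B := i.
  pose r' : hom A S' := r; have rfg : r' ∘ f = r' ∘ g.
    by apply/homP => x; apply: iI; rewrite /= !rP; apply: qfg.
  have [u [/homP uq _]] := qU _ _ rfg.
  have [w [_ wU]] := qU _ _ (iffRL (homP _ _) qfg).
  have wu : w = i' ∘ u.
    by apply: wU; apply/homP => x; rewrite -rP; congr (alg_fun i _); apply: uq.
  have w1 : w = idm B by apply: wU; apply/homP.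
  have /homP iu : i' ∘ u = idm B by rewrite -wu.
  by apply/iP; exists (alg_fun u y); apply: iu.
- have [E [p1 [p2 [[qp _] lift]]]] := variety_pullbackP q q.
  exists E, p1, p2; split=> // D h /homP hp.
  apply: hom_factor_unique => // x qx.
  (* [q x = 0] puts [(x, 0)] in the kernel pair, so [h x = h 0]. *)
  have [|z [<- z0]] := lift x 0; first by rewrite linear0.
  by have /= -> := hp z; rewrite z0 linear0.
Qed.

Lemma variety_coequalisers : has_coequalisers (variety I).
Proof.
move=> A B f g.
have [Q [q [qS qP]]] := @separated_quotientP (sval B)
  (fun D h => forall x, h (alg_fun f x) = h (alg_fun g x)).
exists Q, q; split.
  apply/homP => x /=; apply/subr0_eq; rewrite -linearB /=; apply/qP => D h hfg.
  by rewrite linearB /= hfg subrr.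
move=> D h /homP hfg; apply: hom_factor_unique => // x /qP; exact.
Qed.

(** * The axioms of a homological category *)

Lemma variety_pointed : pointed (variety I).
Proof. by exists zero_object; apply: zero_objectP. Qed.

Lemma variety_has_pullbacks : has_pullbacks (variety I).
Proof.
move=> A B D f g; have [P [p1 [p2 [Ppb _]]]] := variety_pullbackP f g.
by exists P, p1, p2.
Qed.

Lemma variety_regular : regular (variety I).
Proof.
split; [exact: variety_has_pullbacks| |exact: variety_coequalisers|].
  by exists zero_object; case: zero_objectP.
move=> A B D P f g p1 p2 Ppb /regular_epiP gS; apply/regular_epiP => x.
have [y gy] := gS (alg_fun f x).
by have [z [<- _]] := pullback_lift Ppb (esym gy); exists z.
Qed.

(** Uniqueness of factorisations makes [k] monic, hence injective. For the image, the explicit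
    pullback of [g] along the zero object contains every element killed by [g], and its projection
    factors through [k]. *)
Lemma kernelP A B D (k : hom A B) (g : hom B D) : is_kernel k g ->
  injective (alg_fun k) /\
  forall x, alg_fun g x = 0 <-> exists y, alg_fun k y = x.
Proof.
move=> [/zero_morphismP gk kU]; split.
  move=> x y kxy; apply: (@jointly_mono_inj _ _ _ k k) => // Q u v kuv _.
  have [|w [_ wU]] := kU Q (k ∘ u).
    by apply/zero_morphismP => z; apply: gk.
  exact: etrans (esym (wU u erefl)) (wU v (esym kuv)).
move=> x; split=> [gx|[y <-]]; last exact: gk.
have [L [p1 [p2 [[/homP gp _] lift]]]] :=
  variety_pullbackP g (zero_hom _ _ : hom zero_object D).
have [u [/homP ku _]] : exists! u, k ∘ u = p1.
  by apply: kU; apply/zero_morphismP => z; have /= -> := gp z.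
have [z [<- _]] := lift x 0 gx.
by exists (alg_fun u z); apply: ku.
Qed.

Lemma variety_split_short_five : split_short_five (variety I).
Proof.
move=> A B D f g s A' B' D' k q t a b c /kernelP[fI fP] _ /kernelP[kI kP].
move=> /homP qt /homP bf /homP qb /homP bs /iso_bij[aI aS] /iso_bij[cI cS].
apply/iso_bij; split=> [|y].
(* [c (g x) = q (b x) = 0] gives [x = f z]; then [k (a z) = b x = 0] forces [z = 0]. *)
- apply: injective_of_ker => x bx.
  have gx : alg_fun g x = 0.
    by apply: cI; have /= <- := qb x; rewrite bx !linear0.
  have [z zx] := iffLR (fP x) gx.
  have az : alg_fun a z = 0.
    by apply: kI; have /= <- := bf z; rewrite zx bx linear0.
  have z0 : z = 0 by apply: aI; rewrite az linear0.
  by rewrite -zx z0 linear0.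
(* Choose [d] with [c d = q y]. The splittings give [q (b (s d)) = q y], so [y - b (s d)] comes from
   the kernel of [q], which [a] reaches. *)
- have [d cd] := cS (alg_fun q y).
  have [|z kz] := iffLR (kP (y - alg_fun b (alg_fun s d))).
    have /= -> := bs d; have /= qtc := qt (alg_fun c d).
    by rewrite linearB /= qtc cd subrr.
  have [w wz] := aS z.
  exists (alg_fun f w + alg_fun s d).
  have /= bfw := bf w.
  by rewrite linearD /= bfw wz kz subrK.
Qed.

(** * Barr exactness and binary coproducts *)

Lemma variety_barr_exact : barr_exact (variety I).
Proof.
split; first exact: variety_regular.
move=> R A r1 r2 [rI [d [/homP d1 /homP d2]] _ _].
have rinj := jointly_mono_inj rI.
have {d1 d2} [d1 d2] : (forall x, alg_fun r1 (alg_fun d x) = x) /\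
  (forall x, alg_fun r2 (alg_fun d x) = x) by [].
have [|||x y [z [<- z0]]|B [q [qS qP]]] := @quotientP K (sval A)
    (fun x => exists z, alg_fun r1 z = x /\ alg_fun r2 z = 0).
- by exists 0; rewrite !linear0.
- move=> c x y [z [<- z0]] [w [<- w0]]; exists (c *: z + w).
  by rewrite !linearP /= z0 w0 scaler0 addr0.
(* Reflexivity gives absorption: the pair [(x, 0)] times the diagonal pair [(y, y)] is
   [(amul x y, 0)]. *)
- move=> x y [z [<- z0]]; exists (amul z (alg_fun d y)).
  by rewrite !alg_hom_mul d1 d2 z0 amul0l.
- exists (amul (alg_fun d x) z).
  by rewrite !alg_hom_mul d1 d2 z0 amul0r.
pose B' := variety_obj (satisfies_quotient qS).
exists B', q; split.
  apply/homP => z /=; apply/subr0_eq; rewrite -linearB /=; apply/qP.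
  (* Subtracting the diagonal pair [(b, b)] from a related pair [(a, b)] leaves [(a - b, 0)]. *)
  exists (z - alg_fun d (alg_fun r2 z)).
  by rewrite !linearB /= d1 d2 subrr.
move=> Q q1 q2 /homP qq.
have [x|x z z' [e1 e2] [e3 e4]|c x x' z z' [e1 e2] [e3 e4]|
      x x' z z' [e1 e2] [e3 e4]|u uP] := @hom_of_graph K (sval Q) (sval R)
    (fun x z => alg_fun r1 z = alg_fun q1 x /\ alg_fun r2 z = alg_fun q2 x).
(* Conversely, [q1 x - q2 x] is related to 0; adding the diagonal pair at [q2 x] relates [q1 x] to
   [q2 x]. *)
- have [|z [z1 z2]] := iffLR (qP (alg_fun q1 x - alg_fun q2 x)).
    by rewrite linearB /=; have /= -> := qq x; rewrite subrr.
  exists (z + alg_fun d (alg_fun q2 x)).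
  by rewrite !linearD /= d1 d2 z1 z2 subrK add0r.
- by apply: rinj; rewrite (e1, e2) (e3, e4).
- by rewrite !linearP /= e1 e2 e3 e4.
- by rewrite !alg_hom_mul e1 e2 e3 e4.
exists u; split=> [|v [v1 v2]].
  by split; apply/homP => x; have [] := uP x.
by apply: rI; rewrite (v1, v2); apply/homP => x; have [] := uP x.
Qed.

(** The generators are the elements of both algebras. The quotient is taken with respect to the
    morphisms that restrict to morphisms on each summand. *)
Lemma variety_coproducts : has_binary_coproducts (variety I).
Proof.
move=> A B; pose X : choiceType := (sval A + sval B)%type.
have [F [gen [Fext Feq]]] := free_algebraP K X.
pose copair D (f1 : hom A D) (f2 : hom B D) (x : X) : sval D :=
  match x with inl a => alg_fun f1 a | inr b => alg_fun f2 b end.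
have [S [q [qS qP]]] :=
  @separated_quotientP F
    (fun D h => exists f1 f2, forall x, h (gen x) = @copair D f1 f2 x).
have q_eq (x y : F) : (forall D (h : alg_hom F (sval D)) f1 f2,
    (forall z, h (gen z) = copair D f1 f2 z) -> h x = h y) -> q x = q y.
  move=> xy; apply/subr0_eq; rewrite -linearB /=; apply/qP => D h [f1 [f2 hE]].
  by rewrite linearB /= (xy _ _ _ _ hE) subrr.
(* Both coprojections at once. The map to generators is not linear, but every [copair] is a morphism
   along [j], and [q_eq] tests equality in [S] by these alone. *)
have inj (C : algebra K) (j : C -> X) :
    (forall D f1 f2, exists f : alg_hom C (sval D),
      forall x, copair D f1 f2 (j x) = f x) ->
  exists i : alg_hom C (sval S), forall x, i x = q (gen (j x)).
  move=> jP.
  have il : linear (fun x => q (gen (j x))).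
    move=> c x y; rewrite -alg_hom_linear; apply: q_eq => D h f1 f2 hE.
    by have [f fE] := jP D f1 f2; rewrite alg_hom_linear !hE !fE linearP.
  have im : {morph (fun x => q (gen (j x))) : x y / amul x y}.
    move=> x y; rewrite -alg_hom_mul; apply: q_eq => D h f1 f2 hE.
    by have [f fE] := jP D f1 f2; rewrite alg_hom_mul !hE !fE alg_hom_mul.
  by exists (AlgHom il im).
have [D f1 f2|i1 i1E] := inj (sval A) inl; first by exists f1.
have [D f1 f2|i2 i2E] := inj (sval B) inr; first by exists f2.
exists S, i1, i2 => D f1 f2.
have [h hE] := Fext _ (copair D f1 f2).
have [x /qP qx|u uP] := hom_factor qS (h := h).
  by apply: (qx D); exists f1, f2.
exists u; split.
  split; apply/homP => x /=.
  - by rewrite i1E uP hE.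
  - by rewrite i2E uP hE.
move=> v [/homP v1 /homP v2]; apply/homP => y; have [x <-] := qS y.
(* As [q] is onto, uniqueness may be checked after composing with [q], hence on generators. *)
apply: (Feq _ (alg_comp u q) (alg_comp v q)) => -[a|b] /=.
- by rewrite uP hE -i1E; apply/esym/v1.
- by rewrite uP hE -i2E; apply/esym/v2.
Qed.

End Variety.

Theorem theorem10p5 (K : fieldType) (I : na_polynomial K -> Prop) :
  semi_abelian (variety I).
Proof.
split; last exact: variety_coproducts.
- split; [exact: variety_pointed | exact: variety_regular | split].
  + exact: variety_pointed.
  + exact: variety_has_pullbacks.
  + exact: variety_split_short_five.
- exact: variety_barr_exact.
Qed.
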